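(* Let $l,t,s,n$ be integers with $2l+2\leq 2s\leq 2l+t-2$, $l\geq 3$, $t\geq 4$, $t\geq l$, and $n\geq\max\left\{2\binom{3s}{2},\ s+(t-1)\binom{s}{l}+1\right\}$. For integers $x$ let $$F_1(x)=(l-1)n+(t-1)\binom{x}{l}+\binom{2(s-x)+1}{2}-\left\lceil\frac{x(l-1)}{2}\right\rceil.$$ Then $ex(n,\{K_{l,t},M_{s+1}\})=\max\{F_1(l),F_1(s)\}$.
   Context: All graphs are finite and simple. $ex(n,\mathscr{F})$ is the maximum number of edges of an $n$-vertex graph containing no member of $\mathscr{F}$ as a subgraph. $K_{l,t}$ is the complete bipartite graph with parts of sizes $l,t$; $M_{s+1}$ is the matching of $s+1$ disjoint edges. *)

(* Defs.v *)
From mathcomp Require Import all_boot all_order all_algebra.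
Set Implicit Arguments. Unset Strict Implicit. Unset Printing Implicit Defensive.
Import GRing.Theory Num.Theory.

Definition simple_graph (T : finType) (G : rel T) : Prop :=
  (forall x y, G x y = G y x) /\ (forall x, G x x = false).

Definition edges (T : finType) (G : rel T) : {set {set T}} :=
  [set E : {set T} | [exists x, exists y, [&& x != y, G x y & E == [set x; y]]]].

Definition contains_Klt (T : finType) (G : rel T) (l t : nat) : Prop :=
  exists A B : {set T}, [/\ [disjoint A & B], #|A| = l, #|B| = t &
    forall a b, a \in A -> b \in B -> G a b].

Definition contains_matching (T : finType) (G : rel T) (k : nat) : Prop :=
  exists M : {set {set T}}, [/\ M \subset edges G, #|M| = k &
    forall e1 e2, e1 \in M -> e2 \in M -> e1 != e2 -> [disjoint e1 & e2]].

(* F_1(x) from the paper, evaluated over the integers (for nat x <= s). *)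
Definition F1 (l t s n x : nat) : int :=
  ((l - 1) * n)%:Z + ((t - 1) * 'C(x, l))%:Z + ('C((2 * (s - x)).+1, 2))%:Z
  - ((x * (l - 1) + 1) %/ 2)%:Z.

(* Main.v *)
Require Import Defs.
From mathcomp Require Import all_boot all_order all_algebra zify.
Set Implicit Arguments. Unset Strict Implicit. Unset Printing Implicit Defensive.
Import Order.TTheory GRing.Theory Num.Theory.

(** In this range of parameters [F1 l <= F1 s], so the maximum is [F1 s].

    Upper bound: take a maximal vertex set [A] with [#|A| + nu(G - A) <= s] and
    put [k = s - #|A|]. Every vertex outside [A] is missed by some matching of
    size [k] of [G - A], so [G - A] has maximum degree at most [2k] and, by an
    augmenting-path argument, at most [3k^2 - k/2] edges when [k >= 2]. The edges
    meeting [A] are counted through [d <= l - 1 + 'C(d, l)], where [d] is the number of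
    neighbours of a vertex in [A]: [K_{l,t}]-freeness bounds the sum of the
    binomials by [(t - 1) 'C(#|A|, l)], and averaging the bounds for
    [\sum_(v in V)] and [\sum_(v in V \ A)] gives the term [#|A| (l - 1) / 2].
    For [k > 0] the loss [(t - 1) ('C(s, l) - 'C(#|A|, l))] pays for the edges of
    [G - A]; when [#|A| <= l - 2] one uses that [n] is large.

    Lower bound: a core of [s] vertices spanning an almost [(l-1)]-regular graph,
    [t - 1] further vertices joined to each [l]-subset of the core, and all
    remaining vertices joined to one fixed [(l-1)]-subset of it. *)

(** * Counting edges through ordered adjacent pairs *)

Definition nbr (T : finType) (G : rel T) (A : {set T}) (v : T) : {set T} :=
  [set a in A | G v a].

Definition arcs (T : finType) (G : rel T) (A B : {set T}) : nat :=
  \sum_(v in A) #|nbr G B v|.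

Lemma double_count (S T : finType) (X : {set S}) (Y : {set T})
    (r : S -> T -> bool) :
  \sum_(x in X) #|[set y in Y | r x y]| = \sum_(y in Y) #|[set x in X | r x y]|.
Proof.
under eq_bigr => x _ do rewrite -sum1dep_card.
under [RHS]eq_bigr => y _ do rewrite -sum1dep_card.
rewrite (exchange_big_dep (mem Y)) //=; last by move=> x y _ /andP[].
apply: eq_bigr => y Yy; apply: eq_bigl => x.
by rewrite (_ : y \in Y) //=.
Qed.

Lemma arcs_sym (T : finType) (G : rel T) (A B : {set T}) :
  (forall x y, G x y = G y x) -> arcs G A B = arcs G B A.
Proof.
move=> symG; rewrite /arcs double_count; apply: eq_bigr => y _.
by apply: eq_card => x; rewrite !inE symG.
Qed.

Lemma arcs_setUl (T : finType) (G : rel T) (A B C : {set T}) :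
  [disjoint A & B] -> arcs G (A :|: B) C = arcs G A C + arcs G B C.
Proof.
by move=> dAB; rewrite /arcs -bigU //=; apply: eq_bigl => x; rewrite inE.
Qed.

Lemma leq_arcs (T : finType) (G : rel T) (A B : {set T}) (c : nat) :
  (forall v, v \in A -> #|nbr G B v| <= c) -> arcs G A B <= c * #|A|.
Proof. by move=> h; rewrite mulnC -sum_nat_const; apply: leq_sum. Qed.

Lemma edges_card2 (T : finType) (G : rel T) (e : {set T}) :
  e \in edges G -> #|e| = 2.
Proof.
rewrite inE => /existsP[x /existsP[y /and3P[xy _ /eqP->]]].
by rewrite cards2 xy.
Qed.

Lemma mem_edges (T : finType) (G : rel T) (x y : T) :
  simple_graph G -> ([set x; y] \in edges G) = G x y.
Proof.
move=> [symG irrG]; rewrite inE; apply/existsP/idP.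
  move=> [a /existsP[b /and3P[ab Gab /eqP/setP E]]].
  have := E x; have := E y; have := E b; have := E a.
  rewrite !inE !eqxx !orbT /= => Ea Eb /esym/orP[]/eqP yE /esym/orP[]/eqP xE;
    rewrite xE yE // in Ea Eb *.
  - by rewrite orbb eq_sym (negbTE ab) in Eb.
  - by rewrite symG.
  - by rewrite orbb (negbTE ab) in Ea.
move=> Gxy; exists x; apply/existsP; exists y; rewrite Gxy eqxx !andbT.
by apply/eqP => xy; rewrite xy irrG in Gxy.
Qed.

Lemma handshake (T : finType) (G : rel T) :
  simple_graph G -> 2 * #|edges G| = arcs G setT setT.
Proof.
move=> sG; have [symG irrG] := sG.
rewrite mulnC -sum_nat_const.
have cE (e : {set T}) : #|e| = #|[set x in [set: T] | x \in e]|.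
  by apply: eq_card => x; rewrite !inE.
under eq_bigr => e eG do rewrite -(edges_card2 eG) cE.
rewrite double_count; apply: eq_bigr => v _.
(* The edges through [v] correspond to its neighbours; injectivity needs [y != v], which is
   irreflexivity. *)
have <- : #|[set [set v; y] | y in nbr G setT v]| = #|nbr G setT v|.
  apply: card_in_imset => y z; rewrite !inE /= => Gy Gz /setP E.
  have := E y; rewrite !inE eqxx orbT => /esym/orP[]/eqP // yv.
  by rewrite yv irrG in Gy.
apply: eq_card => e; rewrite [LHS]inE; apply/idP/imsetP.
  move=> /andP[eG ve].
  have [a [b [ab E]]] := cards2P _ (introT eqP (edges_card2 eG)).
  move: eG ve; rewrite {}E mem_edges // !inE => Gab /orP[]/eqP->.
    by exists b; rewrite // !inE.
  by exists a; [rewrite !inE symG | exact: setUC].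
by move=> [y /[1!inE] /andP[_ Gvy] ->]; rewrite mem_edges // Gvy set21.
Qed.

Lemma arcs_split (T : finType) (G : rel T) (A : {set T}) :
  (forall x y, G x y = G y x) ->
  arcs G setT setT = arcs G A A + 2 * arcs G (~: A) A + arcs G (~: A) (~: A).
Proof.
move=> symG; have dA : [disjoint A & ~: A].
  by rewrite -setI_eq0 setICr.
have E B : arcs G setT B = arcs G A B + arcs G (~: A) B.
  by rewrite -arcs_setUl // setUCr.
by rewrite E (arcs_sym A _ symG) (arcs_sym (~: A) _ symG) !E (arcs_sym A (~: A)) //; lia.
Qed.

(** For [d < l] the first summand suffices; beyond that, Pascal's rule raises the binomial by at
    least one whenever [d] grows by one. *)
Lemma leq_bin_id (l d : nat) : 0 < l -> d <= l.-1 + 'C(d, l).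
Proof.
case: l => // l _ /=; elim: d => // d IH; rewrite binS.
case: (ltnP d l) => dl; first by lia.
have : 0 < 'C(d, l) by rewrite bin_gt0.
by lia.
Qed.

(* Each [l]-subset of [A] has at most [t - 1] common neighbours, and a vertex with
   [d] neighbours in [A] is a common neighbour of ['C(d, l) >= d - (l - 1)] of them. *)
Lemma arcs_Klt_free (T : finType) (G : rel T) (l t : nat) (A B : {set T}) :
  simple_graph G -> ~ contains_Klt G l t -> 0 < l -> 0 < t ->
  arcs G B A <= l.-1 * #|B| + t.-1 * 'C(#|A|, l).
Proof.
move=> [symG irrG] noK l0 t0.
pose L := [set S : {set T} | S \subset A & #|S| == l].
apply: (@leq_trans (\sum_(v in B) (l.-1 + #|[set S in L | S \subset nbr G A v]|))).
  apply: leq_sum => v _; apply: leq_trans (leq_bin_id _ l0) _.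
  rewrite leq_add2l -cards_draws; apply: subset_leq_card; apply/subsetP => S.
  rewrite !inE => /andP[sS ->]; rewrite sS !andbT.
  by apply: subset_trans sS _; apply/subsetP => x; rewrite inE => /andP[].
rewrite big_split /= sum_nat_const mulnC leq_add2l.
rewrite (double_count B L (fun v S => S \subset nbr G A v)).
rewrite -cards_draws mulnC -/L -sum_nat_const; apply: leq_sum => S.
rewrite inE => /andP[SA /eqP Sl]; rewrite -ltnS prednK // ltnNge; apply/negP => ht.
have [U sU cU] : exists2 U : {set T}, U \subset [set v in B | S \subset nbr G A v] & #|U| = t.
  move/card_geqP: ht => [p [up sp hp]]; exists [set x in p]; last by rewrite cardsE -sp (card_uniqP up).
  by apply/subsetP => x; rewrite inE => /hp.
have SU a b : a \in S -> b \in U -> G a b.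
  move=> aS /(subsetP sU); rewrite inE => /andP[_ /subsetP/(_ _ aS)].
  by rewrite inE symG => /andP[].
apply: noK; exists S, U; split=> //.
rewrite -setI_eq0; apply/eqP/setP => x; rewrite !inE.
by apply/negP => /andP[xS xU]; have := SU _ _ xS xU; rewrite irrG.
Qed.

(** * Matchings avoiding a vertex set *)

Definition matching_off (T : finType) (G : rel T) (A : {set T})
    (M : {set {set T}}) : bool :=
  [&& M \subset edges G, trivIset M & [disjoint cover M & A]].

Lemma cover_setU1 (T : finType) (e : {set T}) (M : {set {set T}}) :
  cover (e |: M) = e :|: cover M.
Proof. by rewrite /cover bigcup_setU big_set1. Qed.

Lemma matching_offU1 (T : finType) (G : rel T) (A : {set T})
    (M : {set {set T}}) (x y : T) :
  simple_graph G -> matching_off G A M -> G x y ->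
  x \notin A :|: cover M -> y \notin A :|: cover M ->
  matching_off G A ([set x; y] |: M) /\ #|[set x; y] |: M| = #|M|.+1.
Proof.
move=> sG /and3P[ME triv off] Gxy; rewrite !inE !negb_or.
move=> /andP[xA xM] /andP[yA yM].
have dis e : e \in M -> [disjoint [set x; y] & e].
  move=> eM; rewrite disjoints_subset; apply/subsetP => z; rewrite !inE.
  by case/orP => /eqP->; [move: xM | move: yM]; apply: contra => ze;
    apply/bigcupP; exists e.
have M0 : set0 \notin M.
  apply/negP => /(subsetP ME)/edges_card2; by rewrite cards0.
have [tr nM] := trivIsetU1 dis triv M0; split; last by rewrite cardsU1 nM.
apply/and3P; split=> //; first by rewrite subUset sub1set mem_edges // Gxy.
rewrite cover_setU1 disjoints_subset subUset -[cover M \subset _]disjoints_subset off andbT.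
by apply/subsetP => z; rewrite !inE => /orP[]/eqP->.
Qed.

Lemma card_cover_matching (T : finType) (G : rel T) (A : {set T})
    (M : {set {set T}}) :
  matching_off G A M -> #|cover M| = 2 * #|M|.
Proof.
move=> /and3P[ME triv _]; have /leqifP := leq_card_cover M; rewrite triv.
move=> /eqP->; rewrite (eq_bigr (fun=> 2)) ?sum_nat_const 1?mulnC //.
by move=> e /(subsetP ME)/edges_card2.
Qed.

Lemma matching_off0 (T : finType) (G : rel T) (s : nat) (M : {set {set T}}) :
  ~ contains_matching G s.+1 -> matching_off G set0 M -> #|M| <= s.
Proof.
move=> noM /and3P[ME triv _]; rewrite leqNgt; apply/negP => /card_geqP[p [up sp hp]].
apply: noM; exists [set e in p]; split.
- by apply/subsetP => e; rewrite inE => /hp/(subsetP ME).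
- by rewrite cardsE -sp (card_uniqP up).
by move=> e f; rewrite !inE => /hp eM /hp fM; apply: (trivIsetP triv).
Qed.

(* Maximality of [A] is what makes the deletion of a further vertex leave the
   matching number unchanged. *)
Lemma matching_core (T : finType) (G : rel T) (s : nat) :
  ~ contains_matching G s.+1 ->
  exists A : {set T}, [/\ #|A| <= s,
    forall M, matching_off G A M -> #|M| <= s - #|A| &
    #|A| < s -> forall u, u \notin A ->
      exists2 M, matching_off G (u |: A) M & #|M| = s - #|A|].
Proof.
move=> noM.
pose P (A : {set T}) := (#|A| <= s) &&
  [forall M, matching_off G A M ==> (#|M| <= s - #|A|)].
have P0 : P set0.
  rewrite /P cards0 subn0; apply/forallP => M; apply/implyP.
  exact: matching_off0.
have [A /maxsetP[/andP[As /forallP AM] maxA]] := ex_maxset (ex_intro P _ P0).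
exists A; split=> // [M hM|lt u uA]; first by move/implyP: (AM M); apply.
have : ~~ P (u |: A).
  apply/negP => /maxA/(_ (subsetUr _ _))/setP/(_ u).
  by rewrite !inE eqxx (negbTE uA).
rewrite /P cardsU1 uA add1n lt /= => /forallPn[M].
rewrite negb_imply -ltnNge => /andP[offM ltM]; exists M => //.
apply/eqP; rewrite eqn_leq; apply/andP; split; last by lia.
move/implyP: (AM M); apply; case/and3P: offM => ME triv off.
apply/and3P; split=> //; apply: disjointWr off; exact: subsetUr.
Qed.

(** A neighbour of [u] outside both [A] and [cover M] would extend [M] to [k + 1] edges, so all
    neighbours counted lie among the [2 * k] covered vertices. *)
Lemma nbr_matching_off (T : finType) (G : rel T) (A : {set T}) (k : nat)
    (M : {set {set T}}) (u : T) :
  simple_graph G -> (forall N, matching_off G A N -> #|N| <= k) ->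
  u \notin A -> matching_off G (u |: A) M -> #|M| = k ->
  #|nbr G (~: A) u| <= 2 * k.
Proof.
move=> sG maxk uA offM Mk.
have offA : matching_off G A M.
  case/and3P: offM => ME triv off; apply/and3P; split=> //.
  by apply: disjointWr off; exact: subsetUr.
rewrite -Mk -(card_cover_matching offA); apply: subset_leq_card.
apply/subsetP => v; rewrite !inE => /andP[vA Guv]; apply/negPn/negP => vM.
have uM : u \notin cover M.
  case/and3P: offM => _ _; rewrite disjoint_sym disjoints_subset.
  by move/subsetP/(_ u (setU11 _ _)); rewrite inE.
have [] := @matching_offU1 _ _ _ _ u v sG offA Guv.
- by rewrite inE negb_or uA.
- by rewrite inE negb_or vA.
by move=> /maxk + c; rewrite c Mk ltnn.
Qed.

Lemma matching_off_indep (T : finType) (G : rel T) (A : {set T}) (k : nat)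
    (M : {set {set T}}) (u v : T) :
  simple_graph G -> (forall N, matching_off G A N -> #|N| <= k) ->
  matching_off G A M -> #|M| = k ->
  u \notin A :|: cover M -> v \notin A :|: cover M -> G u v = false.
Proof.
move=> sG maxk offM Mk hu hv; apply/negP => Guv.
have [/maxk + c] := matching_offU1 sG offM Guv hu hv; by rewrite c Mk ltnn.
Qed.

(** If [a] and [b] differed, [a u v b] would be an augmenting path: trading the edge [uv] for [ua]
    and [vb] gives [k + 1] edges. *)
Lemma matching_off_augment (T : finType) (G : rel T) (A : {set T}) (k : nat)
    (M : {set {set T}}) (u v a b : T) :
  simple_graph G -> (forall N, matching_off G A N -> #|N| <= k) ->
  matching_off G A M -> #|M| = k -> [set u; v] \in M -> u != v ->
  a \notin A :|: cover M -> b \notin A :|: cover M -> G u a -> G v b -> a = b.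
Proof.
move=> sG maxk offM Mk eM uv ha hb Gua Gvb; apply/eqP/negPn/negP => ab.
have [ME triv off] := and3P offM.
have uM : u \in cover M by apply/bigcupP; exists [set u; v]; rewrite ?set21.
have vM : v \in cover M by apply/bigcupP; exists [set u; v]; rewrite ?set22.
have uA : u \notin A by rewrite (disjointFr off).
have vA : v \notin A by rewrite (disjointFr off).
move: ha hb; rewrite !inE !negb_or => /andP[aA aM] /andP[bA bM].
have cov := coverD1 triv eM.
have off1 : matching_off G A (M :\ [set u; v]).
  apply/and3P; split; first exact: subset_trans (subD1set _ _) ME.
    exact: trivIsetS (subD1set _ _) triv.
  by rewrite cov; apply: disjointWl off; exact: subsetDl.
have [||off2 c2] := @matching_offU1 _ _ _ _ u a sG off1 Gua.
- by rewrite cov !inE eqxx (negbTE uA).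
- by rewrite cov !inE (negbTE aA) (negbTE aM) andbF.
have [||off3 c3] := @matching_offU1 _ _ _ _ v b sG off2 Gvb.
- rewrite cover_setU1 cov !inE eqxx (negbTE vA) orbT /= orbF eq_sym (negbTE uv) /=.
  by apply: contraNneq aM => <-.
- rewrite cover_setU1 cov !inE (negbTE bA) (negbTE bM) andbF orbF /= eq_sym negb_or.
  rewrite (eq_sym b) ab andbT; by apply: contraNneq bM => <-.
have cM := cardsD1 [set u; v] M; rewrite eM Mk in cM.
by have := maxk _ off3; rewrite c3 c2 cM ltnn.
Qed.

(** The [2 * k] covered vertices have degree at most [2 * k] each. The uncovered set [I] is
    independent, so the remaining arcs run from [I] to the cover and are counted per edge of [M]. *)
Lemma arcs_off (T : finType) (G : rel T) (A : {set T}) (k : nat)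
    (M : {set {set T}}) :
  simple_graph G -> (forall N, matching_off G A N -> #|N| <= k) ->
  matching_off G A M -> #|M| = k ->
  (forall u, u \notin A -> #|nbr G (~: A) u| <= 2 * k) ->
  arcs G (~: A) (~: A) <= 4 * k ^ 2 + k * maxn 2 (2 * k).-1.
Proof.
move=> sG maxk offM Mk deg; have [symG irrG] := sG.
have [ME triv off] := and3P offM.
pose W := cover M; pose I := ~: (A :|: W).
have WA w : w \in W -> w \notin A by move=> wW; rewrite (disjointFr off wW).
have WI : ~: A = W :|: I.
  apply/setP => x; rewrite !inE; case: (boolP (x \in W)) => [/WA -> //|xW].
  by rewrite orbF.
have dWI : [disjoint W & I].
  by rewrite disjoints_subset; apply/subsetP => x; rewrite !inE => ->; rewrite orbT.
have -> : arcs G (~: A) (~: A) = arcs G W (~: A) + arcs G W I.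
  rewrite {1}WI arcs_setUl //; congr (_ + _).
  rewrite (arcs_sym W I symG); apply: eq_bigr => x xI; apply: eq_card => y.
  rewrite WI !inE; case: (boolP (y \in W)) => //= yW.
  apply/negP => /andP[yA Gxy].
  rewrite orbF in yA; rewrite inE -/W in xI.
  have hy : y \notin A :|: W by rewrite inE negb_or yA.
  by rewrite (matching_off_indep sG maxk offM Mk xI hy) in Gxy.
apply: leq_add.
  apply: leq_trans (leq_arcs (c := 2 * k) _) _.
    by move=> v vW; apply: deg; apply: WA.
  by rewrite (card_cover_matching offM) Mk; lia.
rewrite /arcs big_trivIset //= -[X in X * _]Mk -sum_nat_const; apply: leq_sum => e eM.
have [u [v [uv E]]] := cards2P _ (introT eqP (edges_card2 (subsetP ME _ eM))).
rewrite E in eM *; rewrite big_setU1 ?inE //= big_set1.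
have uW : u \in W by apply/bigcupP; exists [set u; v]; rewrite ?set21.
have vW : v \in W by apply/bigcupP; exists [set u; v]; rewrite ?set22.
have Guv : G u v by rewrite -mem_edges // (subsetP ME).
(* The partner [y] takes up one of the at most [2 * k] neighbours of [x], and it is not in [I]. *)
have big x y : x \in W -> y \in W -> G x y -> #|nbr G I x| <= (2 * k).-1.
  move=> xW yW Gxy; have := deg _ (WA _ xW).
  rewrite (cardsD1 y) !inE (WA _ yW) Gxy /= add1n => h.
  rewrite -ltnS (ltn_predK h); apply: leq_ltn_trans h.
  apply: subset_leq_card; apply/subsetP => z; rewrite !inE negb_or => /andP[/andP[-> zW] ->].
  by rewrite !andbT; apply: contraNneq zW => ->.
(* Either one end of the edge has no neighbour in [I], or augmentation forces both ends to have the
   same single neighbour there; this is the source of the [maxn]. *)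
case: (set_0Vmem (nbr G I u)) => [->|[a aI]].
  by rewrite cards0 add0n leq_max (big v u) // 1?symG // orbT.
case: (set_0Vmem (nbr G I v)) => [->|[b bI]].
  by rewrite cards0 addn0 leq_max (big u v) // orbT.
have eqab x y : x \in nbr G I u -> y \in nbr G I v -> x = y.
  move=> /[1!inE] /andP[/[1!inE] xI Gux] /[1!inE] /andP[/[1!inE] yI Gvy].
  exact: matching_off_augment sG maxk offM Mk eM uv xI yI Gux Gvy.
rewrite leq_max; apply/orP; left; apply: (@leq_add _ _ 1 1).
  by rewrite -(cards1 b); apply: subset_leq_card; apply/subsetP => x xI; rewrite inE (eqab _ _ xI bI).
by rewrite -(cards1 a); apply: subset_leq_card; apply/subsetP => x xI; rewrite inE (eqab _ _ aI xI).
Qed.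

(** * Numerical estimates and the upper bound *)

Lemma leq_bin_linear (l x k : nat) :
  0 < l -> l <= x -> 'C(x, l) + k * l <= 'C(x + k, l).
Proof.
case: l => // l _ lx; elim: k => [|k IH]; first by rewrite mul0n !addn0.
rewrite addnS binS.
(* The increment in Pascal's rule is at least ['C(l.+1, l)], which equals [l.+1]. *)
have : 'C(l.+1, l) <= 'C(x + k, l) by apply: leq_bin2l; lia.
rewrite binSn; lia.
Qed.

Lemma core_decomposition (T : finType) (G : rel T) (s : nat) :
  simple_graph G -> ~ contains_matching G s.+1 -> s < #|T| ->
  exists A : {set T}, #|A| <= s /\ exists2 k, k = s - #|A| &
    arcs G (~: A) (~: A) <= 4 * k ^ 2 + k * maxn 2 (2 * k).-1.
Proof.
move=> sG noM sT; have [A [As maxk avoid]] := matching_core noM.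
exists A; split=> //; exists (s - #|A|) => //.
have avoid' u : u \notin A ->
    exists2 M, matching_off G (u |: A) M & #|M| = s - #|A|.
  (* When [#|A| = s] the required size is [0] and the empty matching serves. *)
  move: As; rewrite leq_eqVlt => /predU1P[->|lt]; last exact: avoid.
  exists set0; last by rewrite cards0 subnn.
  by rewrite /matching_off sub0set /cover big_set0 -!setI_eq0 set0I eqxx /trivIset /cover !big_set0 cards0 eqxx.
have deg u : u \notin A -> #|nbr G (~: A) u| <= 2 * (s - #|A|).
  by move=> uA; have [M offM Mk] := avoid' u uA; apply: nbr_matching_off offM Mk.
have [u uA] : exists u, u \notin A.
  apply/existsP; rewrite -negb_forall; apply/negP => /forallP allA.
  have : #|T| <= #|A|.
    by rewrite -cardsT; apply: subset_leq_card; apply/subsetP => v _; apply: allA.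
  by rewrite leqNgt (leq_ltn_trans As sT).
have [M offM Mk] := avoid' u uA; apply: (arcs_off sG maxk _ Mk deg).
case/and3P: offM => ME triv off; apply/and3P; split=> //.
by apply: disjointWr off; exact: subsetUr.
Qed.

(** Here [x] and [y] are the sizes of [A] and its complement; [Q], [P] and [H] count arcs inside
    [A], from the complement to [A], and inside the complement. Adding [KB] and [KT] bounds
    [Q + 2 * P] and leaves a surplus [x * l.-1]. Everything is doubled to postpone rounding. *)
Lemma upper_numeric (l t s n x y P Q H : nat) :
  2 * l + 2 <= 2 * s -> 2 * s <= 2 * l + t - 2 -> 3 <= l -> 4 <= t ->
  2 * 'C(3 * s, 2) <= n -> x + y = n -> x <= s ->
  Q <= x.-1 * x -> P <= x * y ->
  P <= l.-1 * y + t.-1 * 'C(x, l) -> Q + P <= l.-1 * n + t.-1 * 'C(x, l) ->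
  H <= 4 * (s - x) ^ 2 + (s - x) * maxn 2 (2 * (s - x)).-1 ->
  Q + 2 * P + H + s * l.-1 <= 2 * (l.-1 * n + t.-1 * 'C(s, l)).
Proof.
move=> ls st l3 t4 nb cA As QA PA KB KT HB.
pose k := s - x; rewrite -/k in HB.
case: (posnP k) => [k0|k0].
  rewrite k0 in HB.
  have xs : x = s by lia.
  rewrite xs in KT KB cA; move: KT KB; move: 'C(s, l) => c; nia.
have HB' : H <= 6 * k ^ 2.
  apply: leq_trans HB _; case: (leqP 2 (2 * k).-1); nia.
case: (leqP l x) => lx.
  have := @leq_bin_linear l x k (ltnW (ltnW l3)) lx.
  have -> : x + k = s by lia.
  move: KT KB; move: 'C(s, l) 'C(x, l) => c c' KT KB hc.
  (* From [l <= x] and the upper bound on [s] one gets [t.-1 >= 2 * k + 1]. *)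
  have h1 : (2 * k + 1) * (k * l) <= t.-1 * (c - c') by apply: leq_mul; lia.
  have h2 : t.-1 * c = t.-1 * (c - c') + t.-1 * c' by rewrite -mulnDr; congr (_ * _); lia.
  have h3 : s * l.-1 = x * l.-1 + k * l.-1 by rewrite -mulnDl; congr (_ * _); lia.
  have h4 : l.-1 * n = l.-1 * y + x * l.-1 by rewrite -cA; lia.
  have h5 : 6 * k ^ 2 + k * l.-1 <= 2 * ((2 * k + 1) * (k * l)).
    have : 3 * (k * k) <= l * (k * k) by apply: leq_mul.
    have : k * l.-1 <= k * l by apply: leq_mul; lia.
    rewrite -mulnn; lia.
  lia.
(* With [x <= l - 2] the trivial bounds already give [Q + 2 * P <= 2 * x * n], so [2 * n] is left
   over to absorb terms of order [s ^ 2]. *)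
case: (ltnP x l.-1) => xl.
  have nb' : 9 * s ^ 2 <= n + 3 * s + 1.
    have : 3 * s * (3 * s).-1 + 3 * s = 9 * s ^ 2.
      by rewrite -mulnSr prednK ?expnS; lia.
    by move: nb; rewrite bin2; move: (_ * _.-1) => m; lia.
  have h1 : k ^ 2 <= s ^ 2 by rewrite leq_sqr; lia.
  have h2 : s * l.-1 <= s ^ 2 by apply: leq_mul; lia.
  have h3 : Q + 2 * P <= 2 * (x * n).
    have : x.-1 * x <= x * x by apply: leq_mul; lia.
    by rewrite -cA; lia.
  have h4 : x * n + n <= l.-1 * n by rewrite -mulSnr; apply: leq_mul.
  have h5 : 4 * s <= s ^ 2 by apply: leq_mul; lia.
  clear -h1 h2 h3 h4 h5 nb' HB' ls l3.
  move: (t.-1 * _) (s ^ 2) (k ^ 2) (x * n) (l.-1 * n) (s * l.-1) nb' HB' h1 h2 h3 h4 h5 => *; lia.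
have xl1 : x = l.-1 by lia.
rewrite bin_small // muln0 addn0 in KB.
have k2 : 2 <= k by lia.
have {}HB : H + k <= 6 * k ^ 2.
  move: HB; rewrite (maxn_idPr _); last lia. nia.
have := @leq_bin_linear l l k.-1 (ltnW (ltnW l3)) (leqnn l).
have -> : l + k.-1 = s by lia.
rewrite binn; move: KT; move: 'C(s, l) => c KT hc.
have h1 : (2 * k).-1 * (1 + k.-1 * l) <= t.-1 * c by apply: leq_mul; lia.
have h4 : l.-1 * n = l.-1 * y + x * l.-1 by rewrite -cA; lia.
have h3 : s * l.-1 = x * l.-1 + k * l.-1 by rewrite -mulnDl; congr (_ * _); lia.
have h5 : x.-1 * x + x = x * x by rewrite -mulSnr prednK //; lia.
(* Equality holds at [k = 2], [l = 3]: both the [k] saved in [H] and the [x] saved by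
   [Q <= x.-1 * x] are spent here. *)
have h6 : 6 * k ^ 2 + k * l.-1 <= 2 * ((2 * k).-1 * (1 + k.-1 * l)) + l.-1 + k.
  have [j ->] : exists j, k = j.+2 by exists k.-2; lia.
  have [i ->] : exists i, l = i.+3 by exists (l - 3); lia.
  rewrite (_ : (2 * j.+2).-1 = 2 * j + 3) /=; last lia.
  have := (leq0n (j * j), leq0n (j * j * i), leq0n (i * j)).
  by rewrite -mulnn => -[[]]; lia.
rewrite -xl1 in KT h1 h3 h4 h6 *.
move: (k ^ 2) (_ * (1 + _)) (t.-1 * c) h1 h6 HB => kk a T h1 h6 HB.
clear -QA PA HB h1 h3 h4 h5 h6 xl1; lia.
Qed.

Lemma edges_upper (T : finType) (G : rel T) (l t s : nat) :
  2 * l + 2 <= 2 * s -> 2 * s <= 2 * l + t - 2 -> 3 <= l -> 4 <= t ->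
  2 * 'C(3 * s, 2) <= #|T| -> s < #|T| ->
  simple_graph G -> ~ contains_Klt G l t -> ~ contains_matching G s.+1 ->
  2 * #|edges G| + s * l.-1 <= 2 * (l.-1 * #|T| + t.-1 * 'C(s, l)).
Proof.
move=> ls st l3 t4 nb sT sG noK noM.
have [A [As [k kE HB]]] := core_decomposition sG noM sT.
have [symG irrG] := sG.
have l0 : 0 < l by exact: ltn_trans l3.
have t0 : 0 < t by exact: ltn_trans t4.
have KB := arcs_Klt_free A (~: A) sG noK l0 t0.
have := arcs_Klt_free A setT sG noK l0 t0.
have -> : arcs G setT A = arcs G A A + arcs G (~: A) A.
  by rewrite -arcs_setUl ?setUCr // -setI_eq0 setICr.
rewrite cardsT handshake // (arcs_split A symG) => KT.
apply: (upper_numeric (x := #|A|) (y := #|~: A|)) => //.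
- by rewrite cardsC.
- apply: leq_arcs => v vA; rewrite -ltnS prednK; last by apply/card_gt0P; exists v.
  apply: proper_card; apply/properP; split; first by apply/subsetP => a; rewrite inE => /andP[].
  by exists v; rewrite // inE irrG andbF.
- apply: leq_arcs => v _; apply: subset_leq_card.
  by apply/subsetP => a; rewrite inE => /andP[].
- by rewrite -kE.
Qed.

(** * Almost regular graphs from circulants *)

Lemma card_ord_itv (n a b : nat) : b <= n -> #|[set i : 'I_n | a <= i < b]| = b - a.
Proof.
move=> bn; rewrite -sum1dep_card -(big_mkord (fun i => a <= i < b) (fun=> 1)).
rewrite -(big_nat_widen 0 b n (fun i => a <= i)) //.
rewrite -(@big_nat_widenl _ _ _ a 0 b xpredT) //.
by rewrite sum_nat_const_nat muln1.
Qed.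

(** The residues at cyclic distance between [1] and [h] from [0] modulo [n.+1]: the connection set
    of a circulant graph. *)
Definition circ_set (n h : nat) : {set 'I_n.+1} :=
  [set z : 'I_n.+1 | 1 <= z < h.+1] :|: [set z : 'I_n.+1 | n.+1 - h <= z < n.+1].

Lemma card_circ_set (n h : nat) : 2 * h <= n -> #|circ_set n h| = 2 * h.
Proof.
move=> hn; rewrite /circ_set cardsU !card_ord_itv //; last lia.
rewrite (_ : _ :&: _ = set0) ?cards0; first lia.
apply/setP => z; rewrite !inE; lia.
Qed.

Lemma circ_setN (n h : nat) (z : 'I_n.+1) :
  ((- z)%R \in circ_set n h) = (z \in circ_set n h).
Proof.
have hz := ltn_ord z.
rewrite !inE /= !ltn_mod /=; case: (posnP z) => [->|z0].
  rewrite subn0 modnn; lia.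
rewrite modn_small; lia.
Qed.

(** Pairs [i] with [i + n./2]; for odd [n] the last vertex stays unmatched. *)
Definition half_matching (n x y : nat) : bool :=
  (x < n./2) && (y == x + n./2) || (y < n./2) && (x == y + n./2).

Lemma card_half_matching (n : nat) (x : 'I_n) :
  #|[set y : 'I_n | half_matching n x y]| = (x < 2 * n./2).
Proof.
have hx := ltn_ord x; have hn := leq_div2r 2 hx.
case: (ltnP x n./2) => x1.
  have hy : x + n./2 < n by lia.
  rewrite (_ : [set y | _] = [set Ordinal hy]) ?cards1; first lia.
  by apply/setP => y; rewrite !inE /half_matching -val_eqE /=; lia.
case: (ltnP x (2 * n./2)) => x2.
  have hy : x - n./2 < n by lia.
  rewrite (_ : [set y | _] = [set Ordinal hy]) ?cards1 //.
  by apply/setP => y; rewrite !inE /half_matching -val_eqE /=; lia.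
by apply: eq_card0 => y; rewrite !inE /half_matching; lia.
Qed.

(** The chords have cyclic length [n.+1./2 > h], so the matching adds only edges absent from the
    circulant graph. *)
Lemma half_matching_circ_set (n h : nat) (x y : 'I_n.+1) :
  h < n.+1./2 -> half_matching n.+1 x y -> (x - y)%R \notin circ_set n h.
Proof.
move=> hn; have hx := ltn_ord x; have hy := ltn_ord y.
rewrite /half_matching => /orP[] /andP[hlt /eqP E]; rewrite !inE /= modnDmr.
  rewrite (_ : x + (n.+1 - y) = n.+1 - n.+1./2) ?modn_small; lia.
rewrite (_ : x + (n.+1 - y) = n.+1./2 + n.+1) ?modnDr ?modn_small; lia.
Qed.

(* A circulant graph, plus an almost perfect matching along the longest chords when
   [d] is odd. *)
Lemma near_regular_graph (n d : nat) : d < n ->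
  exists C : rel nat, [/\ symmetric C, irreflexive C,
    forall x : 'I_n, #|[set y : 'I_n | C x y]| <= d &
    \sum_(x < n) #|[set y : 'I_n | C x y]| = 2 * (n * d)./2].
Proof.
case: n => // n dn.
(* Going through [inord] puts [C] on [nat], so it can be read on ['I_s] and inside a larger vertex
   set alike. *)
pose C (x y : nat) := (((inord x : 'I_n.+1) - inord y)%R \in circ_set n d./2)
  || odd d && half_matching n.+1 x y.
have cardC (x : 'I_n.+1) :
    #|[set y : 'I_n.+1 | C x y]| = 2 * d./2 + odd d * (x < 2 * n.+1./2).
  rewrite -(card_half_matching x) -(@card_circ_set n); last lia.
  have -> : odd d * #|[set y : 'I_n.+1 | half_matching n.+1 x y]| =
      #|[set y : 'I_n.+1 | odd d && half_matching n.+1 x y]|.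
    case: (odd d); rewrite ?mul1n //= mul0n; apply/esym/eq_card0 => y.
    by rewrite inE.
  have injx : injective (fun y : 'I_n.+1 => (x - y)%R).
    by move=> y z /addrI/oppr_inj.
  rewrite -(card_preimset (circ_set n d./2) injx) -cardsUI.
  rewrite (_ : _ :&: _ = set0) ?cards0 ?addn0.
    by apply: eq_card => y; rewrite !inE /C !inord_val !inE.
  apply/setP => y; rewrite in_set0; apply/negP => /setIP[]; rewrite in_set => xy.
  rewrite in_set => /andP[od hm]; have hd : d./2 < n.+1./2 by lia.
  by have := half_matching_circ_set hd hm; rewrite xy.
exists C; split.
- move=> x y; rewrite /C -circ_setN opprB; congr (_ || (_ && _)).
  by rewrite /half_matching orbC.
- by move=> x; rewrite /C subrr /half_matching !inE /=; lia.
- by move=> x; rewrite cardC; lia.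
rewrite (eq_bigr _ (fun x _ => cardC x)) big_split /= sum_nat_const card_ord.
rewrite -big_distrr /= -[\sum_(i < _) _]/(\sum_(i < n.+1) nat_of_bool _).
rewrite -big_mkcond /= sum1dep_card (eq_card (B := [set i : 'I_n.+1 | 0 <= i < 2 * n.+1./2])).
  rewrite card_ord_itv; last lia.
  (* For odd [d] the matching contributes [2 * n.+1./2] to the degree sum, which falls one short of
     [n.+1] exactly when [n.+1] is odd; this is the rounding in the target. *)
  case: (boolP (odd d)) => od; last nia.
  rewrite (_ : n.+1 * d = n.+1 + (n.+1 * d./2).*2); last nia.
  rewrite halfD odd_double andbF doubleK; lia.
by move=> i; rewrite !inE.
Qed.

(** With [d = s - l], passing from [l] to [s] costs the clique term [d * (2 * d + 1)] and about
    [d * (l - 1) / 2]. Since [t - 1 >= 2 * d + 1] and ['C(s, l) - 1 >= d * l], the binomial term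
    gains enough. *)
Lemma F1_le (l t s n : nat) :
  l < s -> 2 * s <= 2 * l + t - 2 -> 3 <= l ->
  (F1 l t s n l <= F1 l t s n s)%R.
Proof.
move=> ls st l3; rewrite /F1 subnn binn !muln0 (bin_small (isT : 1 < 2)) bin2 /=.
have := @leq_bin_linear l l (s - l) (ltnW (ltnW l3)) (leqnn l).
rewrite subnKC ?(ltnW ls) // binn; move: 'C(s, l) => c hc.
have [k sk] : exists k, s = l + k.+1 by exists (s - l).-1; lia.
rewrite (_ : s - l = k.+1) in hc *; last lia.
have h1 : (2 * k.+1 + 1) * (k.+1 * l) <= (t - 1) * (c - 1) by apply: leq_mul; lia.
have h2 : (t - 1) * c = (t - 1) * (c - 1) + (t - 1).
  by rewrite -mulnSr; congr (_ * _); lia.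
have h3 : s * (l - 1) = l * (l - 1) + k.+1 * (l - 1).
  by rewrite -mulnDl; congr (_ * _); lia.
rewrite h2 h3 muln1 (_ : (_ * _)./2 = k.+1 * (2 * k.+1).+1); last first.
  by rewrite mulnC -mulnA mul2n doubleK.
have h4 : k.+1 * (2 * k.+1).+1 + k.+1 * (l - 1) <= (2 * k.+1 + 1) * (k.+1 * l).
  rewrite mulnCA -mulnDr leq_mul2l /= -addn1.
  apply: (@leq_trans ((2 * k.+1 + 1) * (1 + (l - 1)))); last by rewrite leq_mul2l; lia.
  by rewrite mulnDr muln1 leq_add2l; apply: leq_pmull; lia.
(* This leaves room for rounding in the two halved terms. *)
have h5 : 1 * 2 <= k.+1 * (l - 1) by apply: leq_mul; lia.
lia.
Qed.

(** * The graph attaining the bound *)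

Lemma trivIset_meet_leq (T : finType) (A : {set T}) (M : {set {set T}}) :
  trivIset M -> (forall e, e \in M -> exists2 x, x \in e & x \in A) ->
  #|M| <= #|A|.
Proof.
move=> triv meet; rewrite -sum1_card.
apply: (@leq_trans (\sum_(e in M) \sum_(x in e) (x \in A))).
  apply: leq_sum => e /meet[x xe xA].
  by rewrite (bigD1 x) //= xA.
rewrite -big_trivIset //= -big_mkcondr /= sum1_card.
by apply: subset_leq_card; apply/subsetP => x; rewrite unfold_in /= => /andP[].
Qed.

Definition core (n s : nat) : {set 'I_n} := [set i : 'I_n | i < s].

(* Beyond the first ['C(s, l) * (t - 1)] vertices outside the core the index overflows,
   and the default value of [nth] is the fixed [(l-1)]-subset. *)
Definition attach (l t s n : nat) (i : 'I_n) : {set 'I_n} :=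
  nth (core n l.-1) (enum [set S : {set 'I_n} | S \subset core n s & #|S| == l])
    ((i - s) %/ t.-1).

Definition extremal (l t s n : nat) (C : rel nat) : rel 'I_n := fun x y =>
  if x < s then if y < s then C x y else x \in attach l t s y
  else (y < s) && (y \in attach l t s x).

Lemma card_core (n s : nat) : s <= n -> #|core n s| = s.
Proof. by move=> sn; rewrite -[RHS]subn0 -(card_ord_itv 0 sn); apply: eq_card => i; rewrite !inE. Qed.

Lemma size_lsubsets (l s n : nat) : s <= n ->
  size (enum [set S : {set 'I_n} | S \subset core n s & #|S| == l]) = 'C(s, l).
Proof. by move=> sn; rewrite -cardE cards_draws card_core. Qed.

Lemma attach_sub (l t s n : nat) (i : 'I_n) : l <= s -> attach l t s i \subset core n s.
Proof.
move=> ls; rewrite /attach.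
case: (ltnP ((i - s) %/ t.-1) (size (enum [set S : {set 'I_n} | S \subset core n s & #|S| == l]))) => h.
  by have := mem_nth (core n l.-1) h; rewrite mem_enum inE => /andP[].
by rewrite nth_default //; apply/subsetP => j; rewrite !inE; lia.
Qed.

Lemma card_attach (l t s n : nat) (i : 'I_n) : 1 < t -> 0 < l -> l <= s -> s <= n ->
  #|attach l t s i| = l.-1 + (i - s < 'C(s, l) * t.-1).
Proof.
move=> t1 l0 ls sn; rewrite -ltn_divLR; last by lia.
rewrite -(size_lsubsets l sn) /attach; case: ltnP => h.
  have := mem_nth (core n l.-1) h; rewrite mem_enum inE => /andP[_ /eqP->]; lia.
rewrite nth_default // card_core; lia.
Qed.

(** The vertices attached to [S] lie in one block of [t - 1] consecutive indices, placed according
    to the rank of [S] in the enumeration. *)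
Lemma card_attach_fibre (l t s n : nat) (S : {set 'I_n}) :
  1 < t -> 0 < l -> l <= s -> s + t.-1 * 'C(s, l) <= n ->
  #|S| = l -> #|[set i : 'I_n | (s <= i) && (attach l t s i == S)]| <= t.-1.
Proof.
move=> t1 l0 ls hn Sl; have sn := leq_trans (leq_addr _ _) hn.
pose L := enum [set S : {set 'I_n} | S \subset core n s & #|S| == l].
have szL : size L = 'C(s, l) by apply: size_lsubsets.
case: (boolP (S \in L)) => SL; last first.
  rewrite eq_card0 // => i; rewrite !inE; apply/negP => /andP[_ /eqP E].
  move: SL; rewrite mem_enum inE Sl eqxx andbT -E; exact/negP/negPn/attach_sub.
have qlt : index S L < 'C(s, l) by rewrite -szL index_mem.
have hq : (index S L).+1 * t.-1 <= 'C(s, l) * t.-1 by rewrite leq_mul2r qlt orbT.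
have itv : s + (index S L).+1 * t.-1 <= n by rewrite mulnC in hq; lia.
apply: (@leq_trans #|[set i : 'I_n | s + index S L * t.-1 <= i < s + (index S L).+1 * t.-1]|).
  apply: subset_leq_card; apply/subsetP => i; rewrite !inE => /andP[si /eqP E].
  have hi : (i - s) %/ t.-1 < size L.
    rewrite szL ltn_divLR; last by lia.
    (* The default set has only [l - 1] elements, so [#|S| = l] excludes an overflowing index. *)
    have := card_attach i t1 l0 ls sn; rewrite E Sl; lia.
  have qE : index S L = (i - s) %/ t.-1.
    by rewrite -E /attach -/L index_uniq // enum_uniq.
  have := divn_eq (i - s) t.-1; have : (i - s) %% t.-1 < t.-1 by rewrite ltn_mod; lia.
  rewrite qE mulSn; lia.
rewrite card_ord_itv // mulSn; lia.
Qed.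

Lemma extremal_simple (l t s n : nat) (C : rel nat) :
  symmetric C -> irreflexive C -> simple_graph (@extremal l t s n C).
Proof.
move=> symC irrC; split=> [x y|x]; rewrite /extremal.
  by case: (x < s); case: (y < s) => //=; rewrite symC.
by rewrite irrC; case: (x < s).
Qed.

Lemma nbr_extremal_core (l t s n : nat) (C : rel nat) (x : 'I_n) (xs : x < s) :
  s <= n -> #|nbr (extremal l t s C) (core n s) x| =
    #|[set y : 'I_s | C (Ordinal xs) y]|.
Proof.
move=> sn; rewrite -!sum1dep_card /=.
rewrite (big_ord_widen_cond n (fun y => C x y) (fun=> 1)) //.
by apply: eq_bigl => y; rewrite inE /extremal xs [RHS]andbC; case: (y < s).
Qed.

Lemma nbr_extremal_out (l t s n : nat) (C : rel nat) (x : 'I_n) :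
  s <= x -> l <= s -> nbr (extremal l t s C) (core n s) x = attach l t s x.
Proof.
move=> sx ls; apply/setP => y; rewrite !inE /extremal (ltnNge x) sx /=.
case: (boolP (y \in attach l t s x)) => [|_]; last by rewrite !andbF.
by move/(subsetP (attach_sub t x ls)); rewrite inE => ->.
Qed.

Lemma card_extremal (l t s n : nat) (C : rel nat) :
  1 < t -> 0 < l -> l <= s -> s + t.-1 * 'C(s, l) <= n ->
  symmetric C -> irreflexive C ->
  \sum_(x < s) #|[set y : 'I_s | C x y]| = 2 * (s * l.-1)./2 ->
  #|edges (@extremal l t s n C)| =
    (s * l.-1)./2 + (l.-1 * (n - s) + t.-1 * 'C(s, l)).
Proof.
move=> t1 l0 ls hn symC irrC sumC; have sn := leq_trans (leq_addr _ _) hn.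
have sG := @extremal_simple l t s n C symC irrC.
apply/eqP; rewrite -(eqn_pmul2l (isT : 0 < 2)) handshake //.
rewrite (arcs_split (core n s) sG.1).
have -> : arcs (extremal l t s C) (core n s) (core n s) = 2 * (s * l.-1)./2.
  rewrite -sumC /arcs (eq_bigl (fun x : 'I_n => (x < s))) => [|x]; last by rewrite inE.
  rewrite (big_ord_widen_cond n xpredT (fun x => #|[set y : 'I_s | C x y]|)) //=.
  by apply: eq_bigr => x xs; rewrite nbr_extremal_core.
have -> : arcs (extremal l t s C) (~: core n s) (~: core n s) = 0.
  rewrite /arcs big1 // => x; rewrite !inE => xs; apply: eq_card0 => y.
  rewrite !inE /extremal (negbTE xs); apply/negP => /andP[ys /andP[]].
  by rewrite (negbTE ys).
have -> : arcs (extremal l t s C) (~: core n s) (core n s) =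
    l.-1 * (n - s) + t.-1 * 'C(s, l).
  have outE : ~: core n s = [set i : 'I_n | s <= i < n].
    by apply/setP => i; rewrite !inE ltn_ord andbT -leqNgt.
  rewrite /arcs (eq_bigr (fun i : 'I_n => l.-1 + (i - s < 'C(s, l) * t.-1))).
    rewrite big_split /= sum_nat_const outE card_ord_itv // mulnC; congr (_ + _).
    rewrite -big_mkcondr /= sum1dep_card.
    rewrite -[RHS](addKn s).
    rewrite -(card_ord_itv _ hn); apply: eq_card => i; rewrite !inE.
    by rewrite ltn_ord andbT mulnC; case: (leqP s i) => //= si; rewrite ltn_subLR.
  move=> i; rewrite outE inE => /andP[si _].
  by rewrite nbr_extremal_out // card_attach.
by rewrite addn0 !mulnDr.
Qed.

(** The core is a vertex cover with [s] elements. *)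
Lemma extremal_matching_free (l t s n : nat) (C : rel nat) :
  s <= n -> ~ contains_matching (@extremal l t s n C) s.+1.
Proof.
move=> sn [M [ME Mc dis]]; have triv : trivIset M by apply/trivIsetP.
suff : s.+1 <= s by rewrite ltnn.
rewrite -Mc -[leqRHS](card_core sn); apply: trivIset_meet_leq => // e /(subsetP ME).
rewrite inE => /existsP[x /existsP[y /and3P[_ Gxy /eqP->]]].
case: (ltnP x s) => xs; first by exists x; rewrite ?set21 // inE.
exists y; rewrite ?set22 // inE.
by move: Gxy; rewrite /extremal (ltnNge x) xs => /andP[].
Qed.

(** Common neighbours of [l] core vertices lie outside the core, where degrees into the core are at
    most [l]; they are therefore attached to exactly that set, and at most [t - 1] are. A side
    leaving the core confines the opposite side to an attached set. *)
Lemma extremal_Klt_free (l t s n : nat) (C : rel nat) :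
  1 < t -> 0 < l -> l <= t -> l <= s -> s + t.-1 * 'C(s, l) <= n ->
  symmetric C -> irreflexive C ->
  (forall x : 'I_s, #|[set y : 'I_s | C x y]| <= l.-1) ->
  ~ contains_Klt (@extremal l t s n C) l t.
Proof.
move=> t1 l0 lt ls hn symC irrC degC; have sn := leq_trans (leq_addr _ _) hn.
set G := extremal l t s C.
have [symG _] : simple_graph G by apply: extremal_simple.
have nbr_in (x : 'I_n) : x < s -> #|nbr G (core n s) x| <= l.-1.
  by move=> xs; rewrite (nbr_extremal_core _ _ _ xs).
have nbr_le (x : 'I_n) : #|nbr G (core n s) x| <= l.
  case: (ltnP x s) => xs; first by have := nbr_in _ xs; lia.
  by rewrite nbr_extremal_out // card_attach //; lia.
have key (X Y : {set 'I_n}) : X \subset core n s -> #|X| = l ->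
    (forall x y, x \in X -> y \in Y -> G x y) -> #|Y| <= t.-1.
  move=> XA Xl XY; apply: leq_trans (card_attach_fibre t1 l0 ls hn Xl).
  apply: subset_leq_card; apply/subsetP => y yY; rewrite inE.
  have Xy : X \subset nbr G (core n s) y.
    by apply/subsetP => x xX; rewrite inE (subsetP XA) //= symG XY.
  have sy : s <= y.
    rewrite leqNgt; apply/negP => ys.
    by have := leq_trans (subset_leq_card Xy) (nbr_in _ ys); rewrite Xl; lia.
  rewrite sy -(nbr_extremal_out t C sy ls) eq_sym eqEcard Xy Xl; exact: nbr_le.
move=> [X [Y [_ Xl Yt XY]]].
case: (boolP (X \subset core n s)) => XA.
  by have := key _ _ XA Xl XY; rewrite Yt; lia.
have [x xX xA] := subsetPn XA.
have Yx : Y \subset nbr G (core n s) x.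
  apply/subsetP => y yY; have := XY _ _ xX yY.
  by rewrite !inE in xA *; rewrite /G /extremal (negbTE xA) => /andP[-> ->].
(* The [t] vertices of [Y] fit into a set of at most [l], so [t = l] and the two sides can exchange
   roles. *)
have tl : t = l.
  by have := leq_trans (subset_leq_card Yx) (nbr_le x); rewrite Yt; lia.
have YA : Y \subset core n s.
  by apply: subset_trans Yx _; apply/subsetP => y; rewrite inE => /andP[].
have := key Y X YA; rewrite Yt Xl tl => /(_ erefl).
have YX a b : a \in Y -> b \in X -> G a b by move=> aY bX; rewrite symG XY.
by move=> /(_ YX); lia.
Qed.

Theorem theorem3p7 (l t s n : nat) :
  2 * l + 2 <= 2 * s -> 2 * s <= 2 * l + t - 2 ->
  3 <= l -> 4 <= t -> l <= t ->
  2 * 'C(3 * s, 2) <= n -> s + (t - 1) * 'C(s, l) + 1 <= n ->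
  let m := Num.max (F1 l t s n l) (F1 l t s n s) in
  (exists G : rel 'I_n, [/\ simple_graph G, ~ contains_Klt G l t,
      ~ contains_matching G s.+1 & (#|edges G|%:Z = m)%R]) /\
  (forall G : rel 'I_n, simple_graph G -> ~ contains_Klt G l t ->
      ~ contains_matching G s.+1 -> (#|edges G|%:Z <= m)%R).
Proof.
move=> ls st l3 t4 lt nb hn m.
have ls' : l < s by lia.
have -> : m = F1 l t s n s by rewrite /m; apply: max_r; apply: F1_le.
have hn' : s + t.-1 * 'C(s, l) < n by rewrite -subn1; lia.
have sn : s < n by apply: leq_ltn_trans hn'; apply: leq_addr.
have F1E : F1 l t s n s =
    (((l.-1 * n)%N + (t.-1 * 'C(s, l))%N)%:Z - ((s * l.-1 + 1) %/ 2)%N%:Z)%R.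
  by rewrite /F1 subnn muln0 (bin_small (isT : 1 < 2)) !subn1 addr0 PoszD.
rewrite F1E; split; last first.
  move=> G sG noK noM.
  have := @edges_upper _ G l t s ls st l3 t4; rewrite card_ord.
  move=> /(_ nb sn sG noK noM); move: #|edges G| => e.
  (* Halving the doubled bound rounds [c / 2] up because the edge count is an integer. *)
  move: (l.-1 * n) (t.-1 * _) (s * l.-1) => a b c; lia.
have dn : l.-1 < s by lia.
have [C [symC irrC degC sumC]] := near_regular_graph dn.
have [t1 l0] : 1 < t /\ 0 < l by lia.
exists (extremal l t s C); split.
- exact: extremal_simple.
- exact: extremal_Klt_free (ltnW ls') (ltnW hn') symC irrC degC.
- exact: extremal_matching_free (ltnW sn).
rewrite (card_extremal t1 l0 (ltnW ls') (ltnW hn') symC irrC sumC).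
(* The core has [(s * l.-1)./2] edges instead of [s * l.-1]; the difference is the rounded-up half
   subtracted in [F1]. *)
have : l.-1 * n = l.-1 * (n - s) + s * l.-1 by rewrite (mulnC s) -mulnDr subnK // ltnW.
move: (l.-1 * n) (l.-1 * (n - s)) (t.-1 * _) (s * l.-1) => a b c d; lia.
Qed.
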